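(* For each set $P$ of prime numbers, there is a set $A \subseteq \mathbb{N}$ such that, for every prime $p$, the ratio set $R(A) = \{a/a' : a,a' \in A\}$ is dense in $\mathbb{Q}_p$ if and only if $p \in P$.
   Context: $\mathbb{N} = \{1,2,\ldots\}$; $\mathbb{Q}_p$ denotes the field of $p$-adic numbers with the $p$-adic metric. *)

(* Defs.v *)
From HB Require Import structures.
From mathcomp Require Import all_boot all_order all_algebra ring lra zify.
From mathcomp Require Import generic_quotient ring_quotient.
From mathcomp Require Import boolp classical_sets functions reals topology.
From mathcomp Require Import normedtype.

Set Implicit Arguments.
Unset Strict Implicit.
Unset Printing Implicit Defensive.

Import Order.TTheory GRing.Theory Num.Theory.

Local Open Scope classical_set_scope.
Local Open Scope ring_scope.
Local Open Scope quotient_scope.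

(* The value at 0 is irrelevant: [padic_abs] treats 0 separately. *)
Definition padic_val (p : nat) (x : rat) : int :=
  (logn p `|numq x|%N)%:Z - (logn p `|denq x|%N)%:Z.

Definition padic_abs (p : nat) (x : rat) : rat :=
  if x == 0 then 0 else (p%:R : rat) ^ (- padic_val p x).

Section RatAbs.
Variables (p : nat) (pp : prime p).
Local Notation abs := (padic_abs p).

Lemma padic_val_frac (a b : int) : a != 0 -> b != 0 ->
  padic_val p (a%:~R / b%:~R) = (logn p `|a|%N)%:Z - (logn p `|b|%N)%:Z.
Proof.
move=> a0 b0; set x : rat := _ / _.
have bR0 : (b%:~R : rat) != 0 by rewrite intr_eq0.
have aR0 : (a%:~R : rat) != 0 by rewrite intr_eq0.
have x0 : x != 0 by rewrite mulf_neq0 ?invr_neq0.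
have d0 : ((denq x)%:~R : rat) != 0 by rewrite intr_eq0 denq_neq0.
have E : numq x * b = a * denq x.
  apply: (@intr_inj rat); rewrite !intrM; apply/eqP.
  by rewrite -eqr_div // divq_num_den.
have := congr1 (fun z : int => logn p `|z|%N) E.
rewrite !abszM !lognM ?absz_gt0 ?denq_neq0 ?numq_eq0 // /padic_val.
by lia.
Qed.

Lemma padic_valM x y : x != 0 -> y != 0 ->
  padic_val p (x * y) = padic_val p x + padic_val p y.
Proof.
move=> x0 y0; rewrite -{1}(divq_num_den x) -{1}(divq_num_den y).
rewrite mulf_div -!intrM padic_val_frac ?mulf_neq0 ?denq_neq0 ?numq_eq0 //.
rewrite !abszM !lognM ?absz_gt0 ?denq_neq0 ?numq_eq0 // /padic_val.
by lia.
Qed.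

Let p_gt0 : (0 : rat) < p%:R. Proof. by rewrite ltr0n prime_gt0. Qed.
Let p_gt1 : (1 : rat) < p%:R. Proof. by rewrite ltr1n prime_gt1. Qed.

Lemma padic_abs0 : abs 0 = 0. Proof. by rewrite /padic_abs eqxx. Qed.

Lemma padic_abs1 : abs 1 = 1.
Proof.
rewrite /padic_abs oner_eq0; have := @padic_val_frac 1 1 isT isT.
by rewrite divr1 subrr => ->. Qed.

Lemma padic_abs_ge0 x : 0 <= abs x.
Proof. by rewrite /padic_abs; case: eqP => // _; rewrite exprz_ge0 ?ltW. Qed.

Lemma padic_abs_eq0 x : (abs x == 0) = (x == 0).
Proof.
rewrite /padic_abs; case: (x =P 0) => [_|_]; first by rewrite eqxx.
by rewrite expfz_eq0 (gt_eqF p_gt0) andbF.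
Qed.

Lemma padic_abs_gt0 x : (0 < abs x) = (x != 0).
Proof. by rewrite lt_def padic_abs_ge0 andbT padic_abs_eq0. Qed.

Lemma padic_absM x y : abs (x * y) = abs x * abs y.
Proof.
have [->|x0] := eqVneq x 0; first by rewrite mul0r padic_abs0 mul0r.
have [->|y0] := eqVneq y 0; first by rewrite mulr0 padic_abs0 mulr0.
rewrite /padic_abs mulf_eq0 (negPf x0) (negPf y0) /= padic_valM // opprD.
by rewrite expfzDr // gt_eqF.
Qed.

Lemma padic_absN x : abs (- x) = abs x.
Proof.
have N1 : abs (-1) = 1.
  have := padic_absM (-1) (-1); rewrite mulrNN mulr1 padic_abs1 => /esym/eqP.
  rewrite -expr2 sqrf_eq1 => /orP[/eqP //|/eqP h].
  by have := padic_abs_ge0 (-1); rewrite h.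
by rewrite -mulN1r padic_absM N1 mul1r.
Qed.

Lemma padic_absB x y : abs (x - y) = abs (y - x).
Proof. by rewrite -opprB padic_absN. Qed.

Lemma padic_absV x : abs x^-1 = (abs x)^-1.
Proof.
have [->|x0] := eqVneq x 0; first by rewrite padic_abs0 !invr0 padic_abs0.
have ax0 : abs x != 0 by rewrite padic_abs_eq0.
by apply: (mulfI ax0); rewrite -padic_absM !mulfV // padic_abs1.
Qed.

Lemma padic_abs_le1 x : x != 0 -> (abs x <= 1) = (0 <= padic_val p x).
Proof.
move=> x0; rewrite /padic_abs (negPf x0) -[X in _ <= X](expr0z p%:R) ler_eXz2l //.
by rewrite oppr_le0.
Qed.

Lemma padic_abs_1D x : abs x <= 1 -> abs (1 + x) <= 1.
Proof.
have [->|x0] := eqVneq x 0; first by rewrite addr0 padic_abs1.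
have [->|y0] := eqVneq (1 + x) 0; first by rewrite padic_abs0.
rewrite !padic_abs_le1 // => vx.
have ld : logn p `|denq x|%N = 0%N.
  have [/eqP|h] := posnP (logn p `|denq x|%N); first by move/eqP.
  have hn : (0 < logn p `|numq x|%N)%N by move: vx; rewrite /padic_val; lia.
  have pn : (p %| `|numq x|%N)%N.
    by rewrite -(expn1 p) pfactor_dvdn // absz_gt0 numq_eq0.
  have pd : (p %| `|denq x|%N)%N.
    by rewrite -(expn1 p) pfactor_dvdn // absz_gt0 denq_neq0.
  have : (p %| gcdn `|numq x| `|denq x|)%N by rewrite dvdn_gcd pn.
  by rewrite (eqP (coprime_num_den x)) dvdn1; move: pp => /prime_gt1; lia.
have d0 : ((denq x)%:~R : rat) != 0 by rewrite intr_eq0 denq_neq0.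
have e : 1 + x = (denq x + numq x)%:~R / (denq x)%:~R.
  by rewrite intrD mulrDl mulfV // divq_num_den.
have n0 : denq x + numq x != 0.
  by apply: contra y0 => /eqP h; rewrite e h mul0r.
by rewrite e padic_val_frac ?denq_neq0 // ld subr0.
Qed.

Lemma padic_absD x y : abs (x + y) <= Num.max (abs x) (abs y).
Proof.
wlog le : x y / abs x <= abs y.
  move=> H; case/orP: (le_total (abs x) (abs y)) => [/H //|/H].
  by rewrite addrC maxC.
rewrite (max_idPr le).
have [y0|y0] := eqVneq y 0.
  by move: le; rewrite y0 addr0.
have ay : 0 < abs y by rewrite padic_abs_gt0.
have -> : x + y = y * (1 + x / y) by rewrite mulrDr mulr1 mulrCA mulfV // mulr1 addrC.
rewrite padic_absM ger_pMr //; apply: padic_abs_1D.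
by rewrite padic_absM padic_absV ler_pdivrMr // mul1r.
Qed.

Lemma padic_absB_le x y z : abs (x - z) <= Num.max (abs (x - y)) (abs (y - z)).
Proof. by rewrite -[x - z](subrKA y) padic_absD. Qed.

Lemma padic_abs_isosceles x y : abs (x - y) < abs y -> abs x = abs y.
Proof.
move=> h; apply/eqP; rewrite eq_le; apply/andP; split.
  by have := padic_absD (x - y) y; rewrite subrK (max_idPr (ltW h)).
have := padic_absD x (y - x); rewrite addrC subrK le_max => /orP[//|].
by rewrite padic_absB leNgt h.
Qed.

End RatAbs.

Definition padic_cauchy (p : nat) (u : nat -> rat) : Prop :=
  forall e : rat, 0 < e -> exists N, forall m n, (N <= m)%N -> (N <= n)%N ->
    padic_abs p (u m - u n) < e.

Definition padic_null (p : nat) (u : nat -> rat) : Prop :=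
  forall e : rat, 0 < e -> exists N, forall n, (N <= n)%N -> padic_abs p (u n) < e.

Section Cauchy.
Variables (p : nat) (pp : prime p).
Local Notation abs := (padic_abs p).

Lemma padic_cauchy_cst (c : rat) : padic_cauchy p (cst c).
Proof. by move=> e e0; exists 0%N => m n _ _; rewrite /cst subrr padic_abs0. Qed.

Lemma padic_cauchyB u v :
  padic_cauchy p u -> padic_cauchy p v -> padic_cauchy p (u - v).
Proof.
move=> cu cv e e0; have [N1 h1] := cu e e0; have [N2 h2] := cv e e0.
exists (maxn N1 N2) => m n; rewrite !geq_max => /andP[m1 m2] /andP[n1 n2].
have -> : (u - v) m - (u - v) n = (u m - u n) + (v n - v m).
  by rewrite !fctE; ring.
by rewrite (le_lt_trans (padic_absD pp _ _)) // gt_max h1 ?h2.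
Qed.

Lemma padic_cauchy_bounded u : padic_cauchy p u ->
  exists2 M : rat, 0 < M & exists N, forall n, (N <= n)%N -> abs (u n) <= M.
Proof.
move=> cu; have [N h] := cu 1 ltr01; exists (Num.max 1 (abs (u N))).
  by rewrite lt_max ltr01.
exists N => n Nn; rewrite -[u n](subrK (u N)).
rewrite (le_trans (padic_absD pp _ _)) // ge_max !le_max lexx orbT andbT.
by rewrite ltW // h.
Qed.

Lemma padic_cauchyM u v :
  padic_cauchy p u -> padic_cauchy p v -> padic_cauchy p (u * v).
Proof.
move=> cu cv e e0.
have [M M0 [N3 h3]] := padic_cauchy_bounded cu.
have [K K0 [N4 h4]] := padic_cauchy_bounded cv.
have [N1 h1] := cu (e / K) (divr_gt0 e0 K0).
have [N2 h2] := cv (e / M) (divr_gt0 e0 M0).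
exists (maxn (maxn N1 N2) (maxn N3 N4)) => m n; rewrite !geq_max.
move=> /andP[/andP[m1 m2] /andP[m3 m4]] /andP[/andP[n1 n2] /andP[n3 n4]].
have -> : (u * v) m - (u * v) n = u m * (v m - v n) + (u m - u n) * v n.
  by rewrite !fctE; ring.
rewrite (le_lt_trans (padic_absD pp _ _)) // gt_max !padic_absM //.
apply/andP; split.
  rewrite (le_lt_trans (ler_wpM2r (padic_abs_ge0 pp _) (h3 _ m3))) //.
  by rewrite mulrC -ltr_pdivlMr // h2.
rewrite (le_lt_trans (ler_wpM2l (padic_abs_ge0 pp _) (h4 _ n4))) //.
by rewrite -ltr_pdivlMr // h1.
Qed.

Lemma padic_nullMD u v w : padic_cauchy p u -> padic_null p v ->
  padic_null p w -> padic_null p (u * v + w).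
Proof.
move=> cu nv nw e e0.
have [M M0 [N1 h1]] := padic_cauchy_bounded cu.
have [N2 h2] := nv (e / M) (divr_gt0 e0 M0).
have [N3 h3] := nw e e0.
exists (maxn N1 (maxn N2 N3)) => n; rewrite !geq_max => /and3P[n1 n2 n3].
rewrite !fctE (le_lt_trans (padic_absD pp _ _)) // gt_max h3 // andbT.
rewrite padic_absM // (le_lt_trans (ler_wpM2r (padic_abs_ge0 pp _) (h1 _ n1))) //.
by rewrite mulrC -ltr_pdivlMr // h2.
Qed.

Lemma padic_abs_stationary u : padic_cauchy p u -> ~ padic_null p u ->
  exists2 c : rat, 0 < c & exists N, forall n, (N <= n)%N -> abs (u n) = c.
Proof.
move=> cu /existsNP[e /not_implyP[e0 /forallNP nu]].
have [N h] := cu e e0; have /existsNP[k /not_implyP[Nk /negP]] := nu N.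
rewrite -leNgt => ek; exists (abs (u k)); first exact: lt_le_trans ek.
exists N => n Nn; apply: padic_abs_isosceles => //.
by rewrite (lt_le_trans _ ek) // h.
Qed.

Lemma padic_cauchyV u : padic_cauchy p u -> ~ padic_null p u ->
  padic_cauchy p (fun n => (u n)^-1).
Proof.
move=> cu nu e e0; have [c c0 [N1 h1]] := padic_abs_stationary cu nu.
have [N2 h2] := cu (e * (c * c)) (mulr_gt0 e0 (mulr_gt0 c0 c0)).
exists (maxn N1 N2) => m n; rewrite !geq_max => /andP[m1 m2] /andP[n1 n2].
have um : u m != 0 by rewrite -(padic_abs_gt0 pp) h1.
have un : u n != 0 by rewrite -(padic_abs_gt0 pp) h1.
have -> : (u m)^-1 - (u n)^-1 = (u n - u m) * (u m * u n)^-1.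
  by field; rewrite um un.
rewrite padic_absM // padic_absV // padic_absM // !h1 //.
by rewrite ltr_pdivrMr ?mulr_gt0 // h2.
Qed.

End Cauchy.

Definition padic_cauchy_pred p (pp : prime p) : {pred nat -> rat} :=
  fun u => `[< padic_cauchy p u >].

Lemma padic_cauchy_subring p (pp : prime p) :
  subring_closed (padic_cauchy_pred pp).
Proof.
split=> [|u v /asboolP cu /asboolP cv|u v /asboolP cu /asboolP cv].
- exact/asboolP/padic_cauchy_cst.
- exact/asboolP/padic_cauchyB.
- exact/asboolP/padic_cauchyM.
Qed.

HB.instance Definition _ p (pp : prime p) :=
  GRing.isSubringClosed.Build (nat -> rat) (padic_cauchy_pred pp)
    (padic_cauchy_subring pp).

Record cauchy_seq p (pp : prime p) := CauchySeq {
  cauchy_fun :> nat -> rat;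
  _ : cauchy_fun \in padic_cauchy_pred pp }.

HB.instance Definition _ p (pp : prime p) := [isSub for @cauchy_fun p pp].
HB.instance Definition _ p (pp : prime p) := [Choice of cauchy_seq pp by <:].
HB.instance Definition _ p (pp : prime p) :=
  [SubChoice_isSubComNzRing of cauchy_seq pp by <:].

Lemma cauchy_seqP p (pp : prime p) (u : cauchy_seq pp) : padic_cauchy p u.
Proof. by case: u => u cu; exact/asboolP. Qed.

Section CauchyFun.
Variables (p : nat) (pp : prime p).
Implicit Types (u v : cauchy_seq pp) (n : nat).

Lemma cauchy_fun0 n : (0 : cauchy_seq pp) n = 0.
Proof. by []. Qed.

Lemma cauchy_fun1 n : (1 : cauchy_seq pp) n = 1.
Proof. by []. Qed.

Lemma cauchy_funN u n : (- u) n = - u n.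
Proof. by []. Qed.

Lemma cauchy_funD u v n : (u + v) n = u n + v n.
Proof. by []. Qed.

Lemma cauchy_funM u v n : (u * v) n = u n * v n.
Proof. by []. Qed.

Definition cauchy_funE :=
  (cauchy_fun0, cauchy_fun1, cauchy_funN, cauchy_funD, cauchy_funM).
End CauchyFun.

Definition null_seq p (pp : prime p) : {pred cauchy_seq pp} :=
  fun u => `[< padic_null p u >].

Lemma null_seq_ideal p (pp : prime p) : idealr_closed (@null_seq p pp).
Proof.
split=> [||a u v /asboolP nu /asboolP nv].
- by apply/asboolP => e e0; exists 0%N => n _; rewrite cauchy_funE padic_abs0.
- apply/negP => /asboolP /(_ 1 ltr01)[N /(_ N (leqnn N))].
  by rewrite cauchy_funE padic_abs1.
- by apply/asboolP; apply: padic_nullMD => //; exact: cauchy_seqP.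
Qed.

HB.instance Definition _ p (pp : prime p) :=
  isIdealr.Build (cauchy_seq pp) (@null_seq p pp) (null_seq_ideal pp).

(* Q_p: Cauchy sequences of rationals for the p-adic absolute value, modulo
   the ideal of null sequences. *)
Definition padic p (pp : prime p) : Type := {ideal_quot (@null_seq p pp)}.

HB.instance Definition _ p (pp : prime p) := GRing.ComNzRing.on (padic pp).
HB.instance Definition _ p (pp : prime p) := EqQuotient.on (padic pp).

Section Field.
Variables (p : nat) (pp : prime p).
Implicit Types (u v : cauchy_seq pp) (x y : padic pp).

Lemma padic_pi_eq u v :
  \pi_(padic pp) u = \pi_(padic pp) v <-> padic_null p (u - v).
Proof.
split=> [/eqP|h].
  by rewrite -Quotient.idealrBE => /asboolP.
by apply/eqP; rewrite -Quotient.idealrBE; apply/asboolP.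
Qed.

Lemma padic_pi_eq0 u : \pi_(padic pp) u = 0 <-> padic_null p u.
Proof.
have -> : 0 = \pi_(padic pp) 0 by rewrite rmorph0.
by rewrite padic_pi_eq subr0.
Qed.

Lemma padic_inv_ex x : x != 0 -> exists y, y * x = 1.
Proof.
rewrite -[x]reprK; move: (repr x) => u /eqP /padic_pi_eq0 nu.
have cu := cauchy_seqP u.
have /asboolP cv := padic_cauchyV pp cu nu.
exists (\pi_(padic pp) (CauchySeq cv)); rewrite -rmorphM -(rmorph1 \pi).
apply/padic_pi_eq => e e0.
have [c c0 [N h]] := padic_abs_stationary pp cu nu.
exists N => n Nn; rewrite !cauchy_funE /= mulVf ?subrr ?padic_abs0 //.
by rewrite -(padic_abs_gt0 pp) h.
Qed.

Definition padic_inv x : padic pp := xget 0 [set y | y * x = 1].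

Lemma padic_mulVf x : x != 0 -> padic_inv x * x = 1.
Proof. by move=> /padic_inv_ex h; exact: (xgetPex 0 h). Qed.

Lemma padic_inv0 : padic_inv 0 = 0.
Proof. by apply: xgetPN => y /= /eqP; rewrite mulr0 eq_sym oner_eq0. Qed.

End Field.

HB.instance Definition _ p (pp : prime p) :=
  GRing.ComNzRing_isField.Build (padic pp)
    (@padic_mulVf p pp) (@padic_inv0 p pp).

(* The absolute value of the class of (u_n) is lim |u_n|_p. It is valued in rat,
   as the p-adic absolute value only takes the value 0 and powers of p. *)
Definition padic_norm p (pp : prime p) (x : padic pp) : rat :=
  lim ((fun n => padic_abs p (repr x n) : rat^o) @ \oo).

Section Norm.
Variables (p : nat) (pp : prime p).
Local Notation abs := (padic_abs p).
Implicit Types (u v : cauchy_seq pp) (x y : padic pp).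

Lemma padic_norm_stationary u : \pi_(padic pp) u <> 0 ->
  0 < padic_norm (\pi_(padic pp) u) /\
  exists N, forall n, (N <= n)%N -> abs (u n) = padic_norm (\pi_(padic pp) u).
Proof.
move=> u0; set w := repr (\pi_(padic pp) u).
have wu : \pi_(padic pp) w = \pi_(padic pp) u by rewrite /w reprK.
have nw : ~ padic_null p w by rewrite -padic_pi_eq0 wu.
have [c c0 [N h]] := padic_abs_stationary pp (cauchy_seqP w) nw.
have -> : padic_norm (\pi_(padic pp) u) = c.
  rewrite /padic_norm -/w; apply: (@cvg_lim rat^o); first exact: metric_hausdorff.
  apply: cvg_near_cst; exists N => // n /= Nn; exact/eqP/h.
have /esym/padic_pi_eq /(_ c c0)[K hK] := wu.
split=> //; exists (maxn N K) => n; rewrite geq_max => /andP[Nn Kn].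
by rewrite -(h n Nn); apply: padic_abs_isosceles => //; rewrite h // hK.
Qed.

Lemma padic_norm0 : padic_norm (0 : padic pp) = 0.
Proof.
have n0 : padic_null p (repr (0 : padic pp)) by apply/padic_pi_eq0; rewrite reprK.
apply: (@cvg_lim rat^o); first exact: metric_hausdorff.
apply/cvgrPdist_lt => e e0; have [N h] := n0 e e0.
by exists N => // n /= Nn; rewrite sub0r normrN ger0_norm ?padic_abs_ge0 // h.
Qed.

Lemma padic_norm_ge0 x : 0 <= padic_norm x.
Proof.
have [->|/eqP] := eqVneq x 0; first by rewrite padic_norm0.
by rewrite -[x]reprK => /padic_norm_stationary[/ltW].
Qed.

Lemma padic_norm_eq0 x : padic_norm x = 0 -> x = 0.
Proof.
move=> nx; apply: contrapT; rewrite -[x]reprK => /padic_norm_stationary[].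
by rewrite reprK nx ltxx.
Qed.

Lemma padic_norm_near u (e : rat) : 0 < e -> exists N, forall n, (N <= n)%N ->
  `|abs (u n) - padic_norm (\pi_(padic pp) u)| < e.
Proof.
move=> e0; have [u0|/eqP u0] := eqVneq (\pi_(padic pp) u) 0.
  rewrite u0 padic_norm0; have [N h] := (padic_pi_eq0 u).1 u0 e e0.
  by exists N => n Nn; rewrite subr0 ger0_norm ?padic_abs_ge0 // h.
have [_ [N h]] := padic_norm_stationary u0.
by exists N => n Nn; rewrite h // subrr normr0.
Qed.

Lemma padic_norm_unique u (c : rat) :
  (forall e, 0 < e -> exists N, forall n, (N <= n)%N -> `|abs (u n) - c| < e) ->
  padic_norm (\pi_(padic pp) u) = c.
Proof.
move=> h; apply/eqP; rewrite -subr_eq0 -normr_le0; apply/ler_addgt0Pl => e e0.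
have e20 : 0 < e / 2 by rewrite divr_gt0.
have [N hN] := h _ e20; have [K hK] := padic_norm_near u e20.
have := hN _ (leq_maxl N K); have := hK _ (leq_maxr N K).
move: (abs _) (padic_norm _) => a b hb hc.
rewrite addr0 ltW // [e]splitr -(subrKA a) (le_lt_trans (ler_normD _ _)) //.
by rewrite ltrD // distrC.
Qed.

Lemma padic_normN x : padic_norm (- x) = padic_norm x.
Proof.
rewrite -[x]reprK -rmorphN; apply: padic_norm_unique => e e0.
have [N h] := padic_norm_near (repr x) e0; exists N => n Nn.
by rewrite cauchy_funE padic_absN // h.
Qed.

Lemma padic_normD x y :
  padic_norm (x + y) <= Num.max (padic_norm x) (padic_norm y).
Proof.
rewrite -[x]reprK -[y]reprK -rmorphD; apply/ler_addgt0Pl => e e0.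
have e20 : 0 < e / 2 by rewrite divr_gt0.
have [N hN] := padic_norm_near (repr x) e20.
have [K hK] := padic_norm_near (repr y) e20.
have [L hL] := padic_norm_near (repr x + repr y) e20.
pose n := maxn L (maxn N K).
have Ln : (L <= n)%N by rewrite leq_maxl.
have Nn : (N <= n)%N by rewrite leq_max leq_maxl orbT.
have Kn : (K <= n)%N by rewrite leq_max leq_maxr orbT.
have := hN n Nn; have := hK n Kn; have := hL n Ln; rewrite !cauchy_funE.
have := padic_absD pp (repr x n) (repr y n).
rewrite !ltr_norml le_max => /orP[] h /andP[l1 l2] /andP[k1 k2] /andP[n1 n2];
  have := le_max (padic_norm (\pi_(padic pp) (repr x)))
    (padic_norm (\pi_(padic pp) (repr x)))
    (padic_norm (\pi_(padic pp) (repr y)));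
  have := le_max (padic_norm (\pi_(padic pp) (repr y)))
    (padic_norm (\pi_(padic pp) (repr x)))
    (padic_norm (\pi_(padic pp) (repr y)));
  rewrite !lexx ?orbT; lra.
Qed.

Lemma padic_normM x y : padic_norm (x * y) = padic_norm x * padic_norm y.
Proof.
have [->|x0] := eqVneq x 0; first by rewrite mul0r padic_norm0 mul0r.
have [->|y0] := eqVneq y 0; first by rewrite mulr0 padic_norm0 mulr0.
move/eqP: x0; move/eqP: y0; rewrite -[x]reprK -[y]reprK.
move=> /padic_norm_stationary[_ [N hN]] /padic_norm_stationary[_ [K hK]].
rewrite -rmorphM; apply: padic_norm_unique => e e0.
exists (maxn N K) => n; rewrite geq_max => /andP[Nn Kn].
by rewrite !cauchy_funE padic_absM // hN // hK // subrr normr0.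
Qed.

Definition padic_dist x y : rat := padic_norm (x - y).

Lemma padic_distxx x : padic_dist x x = 0.
Proof. by rewrite /padic_dist subrr padic_norm0. Qed.

Lemma padic_dist_positivity x y : padic_dist x y = 0 -> x = y.
Proof. by move=> /padic_norm_eq0/eqP; rewrite subr_eq0 => /eqP. Qed.

Lemma padic_dist_sym x y : padic_dist x y = padic_dist y x.
Proof. by rewrite /padic_dist -opprB padic_normN. Qed.

Lemma padic_dist_triangle y x z :
  padic_dist x z <= padic_dist x y + padic_dist y z.
Proof.
rewrite /padic_dist -[x - z](subrKA y) (le_trans (padic_normD _ _)) //.
by rewrite ge_max lerDl lerDr !padic_norm_ge0.
Qed.

End Norm.

HB.instance Definition _ p (pp : prime p) := isMetric.Build rat (padic pp)
  (@padic_distxx p pp) (@padic_dist_positivity p pp)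
  (@padic_dist_sym p pp) (@padic_dist_triangle p pp).

(* padic pp is the completion of (rat, padic_abs p), embedded by [ratr]. *)
Section Completion.
Variables (p : nat) (pp : prime p).

Lemma cst_cauchy (q : rat) : cst q \in padic_cauchy_pred pp.
Proof. exact/asboolP/padic_cauchy_cst. Qed.

Definition padic_of_rat (q : rat) : padic pp :=
  \pi_(padic pp) (CauchySeq (cst_cauchy q)).

Lemma padic_of_rat_zmod : zmod_morphism padic_of_rat.
Proof.
by move=> q r; rewrite /padic_of_rat -rmorphB; congr (\pi _); exact: val_inj.
Qed.

Lemma padic_of_rat_monoid : monoid_morphism padic_of_rat.
Proof.
split=> [|q r]; rewrite /padic_of_rat ?(=^~ rmorphM, =^~ rmorph1 \pi_(padic pp));
  by congr (\pi _); exact: val_inj.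
Qed.

HB.instance Definition _ := GRing.isZmodMorphism.Build rat (padic pp)
  padic_of_rat padic_of_rat_zmod.
HB.instance Definition _ := GRing.isMonoidMorphism.Build rat (padic pp)
  padic_of_rat padic_of_rat_monoid.

Lemma padic_ratrE (q : rat) : ratr q = padic_of_rat q.
Proof. by rewrite -{2}(divq_num_den q) fmorph_div !rmorph_int. Qed.

Lemma padic_norm_ratr (q : rat) : padic_norm (ratr q : padic pp) = padic_abs p q.
Proof.
rewrite padic_ratrE; apply: padic_norm_unique => e e0.
by exists 0%N => n _ /=; rewrite subrr normr0.
Qed.

Lemma padic_norm_approx (u : cauchy_seq pp) (e : rat) : 0 < e ->
  exists N, forall n, (N <= n)%N -> padic_norm (\pi_(padic pp) u - ratr (u n)) < e.
Proof.
move=> e0; have e20 : 0 < e / 2 by rewrite divr_gt0.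
have [N h] := cauchy_seqP u e20; exists N => n Nn.
rewrite padic_ratrE /padic_of_rat -rmorphB.
set w := u - _.
have [K hK] := padic_norm_near w e20.
have := hK _ (leq_maxl K N); have := h _ n (leq_maxr K N) Nn.
have -> : w (maxn K N) = u (maxn K N) - u n by [].
rewrite ltr_norml => h1 /andP[h2 h3]; lra.
Qed.

Lemma padic_rat_dense : dense (range (ratr : rat -> padic pp)).
Proof.
move=> O [x Ox] oO; have : nbhs x O by exact: open_nbhs_nbhs.
rewrite -nbhs_ballE => -[e /= e0 xO].
have [N h] := padic_norm_approx (repr x) e0.
exists (ratr (repr x N)); split; last by exists (repr x N).
apply: xO; rewrite ballEmdist /= -[X in mdist X _](reprK x).
exact: h.
Qed.

Lemma padic_complete (x : nat -> padic pp) :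
  (forall e : rat, 0 < e -> exists N, forall m n, (N <= m)%N -> (N <= n)%N ->
    mdist (x m) (x n) < e) ->
  exists l, forall e : rat, 0 < e -> exists N, forall n, (N <= n)%N ->
    mdist l (x n) < e.
Proof.
move=> cx.
have inv0 k : 0 < (k.+1%:R : rat)^-1 by rewrite invr_gt0 ltr0n.
have /choice[q hq] : forall k, exists q : rat,
    padic_norm (x k - ratr q) < k.+1%:R^-1.
  move=> k; have [N h] := padic_norm_approx (repr (x k)) (inv0 k).
  by exists (repr (x k) N); have := h N (leqnn N); rewrite reprK.
have small (e : rat) : 0 < e ->
    exists N, forall n, (N <= n)%N -> padic_norm (x n - ratr (q n)) < e.
  move=> e0; exists (Num.bound e^-1) => n Nn; apply: lt_trans (hq n) _.
  rewrite invf_plt ?posrE ?ltr0n //.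
  apply: lt_le_trans (archi_boundP (ltW _)) _; first by rewrite invr_gt0.
  by rewrite ler_nat leqW.
have cq : q \in padic_cauchy_pred pp.
  apply/asboolP => e e0; have [N hN] := cx e e0; have [K hK] := small e e0.
  exists (maxn N K) => m n; rewrite !geq_max => /andP[Nm Km] /andP[Nn Kn].
  rewrite -padic_norm_ratr.
  have -> : ratr (q m - q n) = - (x m - ratr (q m)) +
      ((x m - x n) + (x n - ratr (q n))) :> padic pp.
    by rewrite !padic_ratrE rmorphB; ring.
  rewrite (le_lt_trans (padic_normD _ _)) // gt_max padic_normN hK //=.
  by rewrite (le_lt_trans (padic_normD _ _)) // gt_max hK // hN.
exists (\pi_(padic pp) (CauchySeq cq)) => e e0.
have [N hN] := padic_norm_approx (CauchySeq cq) e0; have [K hK] := small e e0.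
exists (maxn N K) => n; rewrite geq_max => /andP[Nn Kn].
rewrite [mdist _ _](_ : _ = padic_norm ((\pi_(padic pp) (CauchySeq cq) - ratr (q n))
   + - (x n - ratr (q n)))); last by congr padic_norm; ring.
rewrite (le_lt_trans (padic_normD _ _)) // gt_max padic_normN hK // andbT.
exact: hN.
Qed.

End Completion.

Definition ratio_set (A : set nat) : set rat :=
  [set r | exists a a' : nat, [/\ A a, A a' & r = a%:R / a'%:R]].

(* Main.v *)
Require Import Defs.
From HB Require Import structures.
From mathcomp Require Import all_boot all_order all_algebra.
From mathcomp Require Import boolp classical_sets functions reals topology.
From mathcomp Require Import ring zify.

Import Order.TTheory GRing.Theory Num.Theory.

Local Open Scope classical_set_scope.
Local Open Scope ring_scope.

(** Take A to be the set of positive a with v_q(a) <= q for every prime q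
outside P.  For such q the quotients of elements of A have q-adic valuation at
most q, so none of them is close to q^(q+1).  For p in P, A meets every residue
class m modulo every power B = p^n: the Chinese remainder theorem gives
a = m modulo B with a prime to every prime q <= B other than p and with
a < B * B!, and a prime q > B has q^(q+1) > B^(B+1) >= B * B!, so that
v_q(a) <= q.  Approximating numerator and denominator of a rational separately
then makes the quotients dense in Q, hence in Q_p. *)

Definition bounded_val (P : set nat) : set nat :=
  [set a | (0 < a)%N /\ forall q, prime q -> ~ P q -> (logn q a <= q)%N].

(** Each of the [n] factors of the factorial is at most [n]. *)
Lemma fact_leq_expn n : (n`! <= n ^ n)%N.
Proof.
rewrite fact_prod -[X in (_ <= _ ^ X)%N](subn1 n.+1) -prod_nat_const_nat.
by rewrite !big_nat; apply: leq_prod => i; rewrite ltnS => /andP[_ ?].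
Qed.

Lemma bounded_val_mod (P : set nat) (p n m : nat) : prime p -> P p ->
  exists2 a, bounded_val P a & a = m %[mod p ^ n].
Proof.
move=> pp Pp; set B := (p ^ n)%N.
have B0 : (0 < B)%N by rewrite expn_gt0 prime_gt0.
(* If [B] divides [m], then [B] itself works: its only possible prime factor [p] lies in [P].
   Otherwise [m] is nonzero modulo [B], which later makes [a] positive. *)
have [Bm|Bm] := boolP (B %| m)%N.
  exists B; last by rewrite modnn (eqP Bm).
  split=> // q pq Pq; rewrite lognX logn_prime //.
  by case: eqP => [qp|_]; [rewrite qp in Pq | rewrite muln0].
(* The prime-to-[p] part of the factorial is coprime to [B], yet divisible by every prime up to [B]
   other than [p]. *)
pose Q := partn B`! (negn p).
have Q0 : (0 < Q)%N by rewrite part_gt0.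
have cBQ : coprime B Q.
  by apply: (@pnat_coprime p); rewrite ?part_pnat // pnatX pnat_id.
pose a := (chinese B Q m 1 %% (B * Q))%N.
have aB : a = m %[mod B].
  by rewrite modn_dvdm ?dvdn_mulr // chinese_modl.
have aQ : a = 1 %[mod Q] by rewrite modn_dvdm ?dvdn_mull // chinese_modr.
have a0 : (0 < a)%N.
  rewrite lt0n; apply: contraNneq Bm => a0.
  by rewrite /dvdn -aB a0 mod0n.
exists a => //; split=> // q pq Pq.
have qp : q != p by apply/eqP => qp; rewrite qp in Pq.
have [qB|Bq] := leqP q B.
  suff: ~~ (q %| a)%N by rewrite lognE pq a0 /= => /negPf ->.
  have qQ : (q %| Q)%N.
    rewrite -(@part_pnat_id q q) ?pnat_id //.
    apply: dvdn_trans (_ : partn B`! q %| _)%N.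
      by apply: partn_dvd; rewrite ?fact_gt0 // dvdn_fact // prime_gt0.
    by apply: sub_in_partn => // r _ /eqP ->; rewrite !inE.
  by rewrite /dvdn -(modn_dvdm _ qQ) aQ modn_dvdm // -/(dvdn _ _) Euclid_dvd1.
rewrite leqNgt; apply/negP => qa.
have : (q ^ q.+1 <= a)%N.
  by apply: dvdn_leq => //; rewrite pfactor_dvdn.
apply/negP; rewrite -ltnNge.
apply: (@leq_trans (B * Q)); first by rewrite ltn_mod muln_gt0 B0.
apply: (@leq_trans (B * B`!)).
  by rewrite leq_mul2l (dvdn_leq (fact_gt0 _)) ?dvdn_part ?orbT.
apply: (@leq_trans (B ^ B.+1)).
  by rewrite expnS leq_mul2l fact_leq_expn orbT.
apply: (@leq_trans (q ^ B.+1)); first by rewrite leq_exp2r // ltnW.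
by rewrite leq_exp2l ?prime_gt1 // ltnW.
Qed.

Lemma padic_abs_int_le (p n : nat) (z : int) : prime p ->
  (p ^ n %| `|z|)%N -> padic_abs p z%:~R <= (p%:R ^- n : rat).
Proof.
move=> pp dz; rewrite /padic_abs.
have p0 : 0 < p%:R :> rat by rewrite ltr0n prime_gt0.
case: eqP => [_|/eqP]; first by rewrite invr_ge0 exprn_ge0 // ltW.
rewrite intr_eq0 => z0.
have := @padic_val_frac p pp z 1 z0 isT; rewrite divr1 => ->.
rewrite logn1 subr0 exprnN ler_eXz2l ?ltr1n ?prime_gt1 //.
by rewrite lerN2 lez_nat -pfactor_dvdn // absz_gt0.
Qed.

Lemma expVr_small (p : nat) (e : rat) : (1 < p)%N -> 0 < e ->
  exists n, p%:R ^- n < e.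
Proof.
move=> p1 e0; exists (Num.bound e^-1).
rewrite invf_plt ?posrE ?exprn_gt0 ?ltr0n ?(ltnW p1) //.
apply: lt_trans (archi_boundP (ltW _)) _; first by rewrite invr_gt0.
by rewrite -natrX ltr_nat ltn_expl.
Qed.

Lemma padic_ratio_approx (p : nat) (A : set nat) (r e : rat) : prime p ->
  (forall n m : nat, exists2 a, A a & a = m %[mod p ^ n]) -> 0 < e ->
  exists2 s, ratio_set A s & padic_abs p (r - s) < e.
Proof.
move=> pp hA e0; set z := numq r; set d := denq r.
have d0 : (d%:~R : rat) != 0 by rewrite intr_eq0 denq_neq0.
have cd0 : 0 < padic_abs p d%:~R by rewrite padic_abs_gt0.
set c := padic_abs p d%:~R in cd0 *.
(* The bound by [c] forces [b], close to [d], to have absolute value [c] too, so [b] is nonzero; the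
   other bound absorbs the denominator [d * b] of [r - a / b], of absolute value [c * c]. *)
have [n] : exists n, p%:R ^- n < Num.min c (e * (c * c)).
  by apply: expVr_small; rewrite ?prime_gt1 // lt_min cd0 !mulr_gt0.
rewrite lt_min => /andP[nc ne].
have approx (x : int) : exists2 a : nat, A a &
    padic_abs p (a%:R - x%:~R) <= p%:R ^- n.
  have pn0 : (p ^ n)%:Z != 0 by rewrite -lt0n expn_gt0 prime_gt0.
  (* [hA] concerns natural residues only, so the possibly negative [x] is reduced modulo [p ^ n]
     first. *)
  have [a Aa am] := hA n `|(x %% (p ^ n)%:Z)%Z|%N.
  exists a => //; rewrite -[a%:R]/(a%:Z%:~R) -intrB.
  apply: padic_abs_int_le => //.
  rewrite -[(_ %| _)%N]/((p ^ n)%:Z %| a%:Z - x)%Z -eqz_mod_dvd.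
  apply/eqP; rewrite -[RHS]modz_mod -(gez0_abs (modz_ge0 x pn0)).
  by rewrite !modz_nat am.
have [a Aa ha] := approx z; have [b Ab hb] := approx d.
have absb : padic_abs p b%:R = c.
  by apply: padic_abs_isosceles => //; apply: le_lt_trans nc.
have b0 : b%:R != 0 :> rat by rewrite -(padic_abs_gt0 pp) absb.
exists (a%:R / b%:R); first by exists a, b.
have -> : r - a%:R / b%:R =
    (z%:~R * (b%:R - d%:~R) + - (d%:~R * (a%:R - z%:~R))) / (d%:~R * b%:R).
  by rewrite -[r]divq_num_den -/z -/d; field; rewrite b0 d0.
rewrite padic_absM // padic_absV // padic_absM // absb -/c.
rewrite ltr_pdivrMr ?mulr_gt0 //; apply: le_lt_trans ne.
have int_le1 (x : int) : padic_abs p x%:~R <= 1.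
  by have := @padic_abs_int_le p 0 x pp; rewrite expn0 dvd1n expr0 invr1; apply.
rewrite (le_trans (padic_absD pp _ _)) // padic_absN // !padic_absM //.
have pn0 : 0 <= p%:R ^- n :> rat by rewrite invr_ge0 exprn_ge0.
by rewrite ge_max; apply/andP; split;
  rewrite -[leRHS]mul1r ler_pM ?padic_abs_ge0.
Qed.

Lemma padic_mdist_ratr (p : nat) (pp : prime p) (r s : rat) :
  mdist (ratr r : padic pp) (ratr s) = padic_abs p (r - s).
Proof.
by rewrite -(@padic_norm_ratr p pp) !padic_ratrE rmorphB.
Qed.

Theorem theorem3p1 (P : set nat) (hP : forall p : nat, P p -> prime p) :
  exists A : set nat,
    (forall a : nat, A a -> (0 < a)%N) /\
    (forall (p : nat) (pp : prime p),
       dense ((ratr : rat -> padic pp) @` ratio_set A) <-> P p).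
Proof.
exists (bounded_val P); split=> [a []//|p pp]; split=> [dA|Pp].
  apply: contrapT => nPp.
  have p0 : 0 < p%:R :> rat by rewrite ltr0n prime_gt0.
  (* With the absolute value of the centre as radius, all rationals in the ball share that absolute
     value. *)
  pose e : rat := padic_abs p (p%:R ^+ p.+1).
  have e0 : 0 < e by rewrite padic_abs_gt0 // expf_neq0 // gt_eqF.
  pose x : padic pp := ratr (p%:R ^+ p.+1).
  have ne : (ball x e)° !=set0 by exists x; exact: nbhsx_ballx.
  have [y [/interior_subset xy]] := dA _ ne (open_interior _).
  move=> [s [a [b [[a0 ha] [b0 hb] sE]]] sy].
  move: xy; rewrite ballEmdist /= -sy padic_mdist_ratr padic_absB //.
  move=> /(padic_abs_isosceles pp).
  rewrite /padic_abs expf_eq0 (gt_eqF p0) /= sE.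
  have aR0 : a%:R != 0 :> rat by rewrite pnatr_eq0 -lt0n.
  have bR0 : b%:R != 0 :> rat by rewrite pnatr_eq0 -lt0n.
  rewrite mulf_eq0 invr_eq0 (negPf aR0) (negPf bR0) /=.
  have -> : (p%:R ^+ p.+1 : rat) = (p ^ p.+1)%:Z%:~R / 1%:Z%:~R.
    by rewrite divr1 -natrX.
  have p1 : p%:R != 1 :> rat by rewrite gt_eqF // ltr1n prime_gt1.
  rewrite -[a%:R]/(a%:Z%:~R) -[b%:R]/(b%:Z%:~R).
  rewrite !padic_val_frac -?lt0n ?expn_gt0 ?(prime_gt0 pp) //.
  (* Comparing exponents of [p] gives v_p(a) - v_p(b) = p + 1, against v_p(a) <= p. *)
  move=> /(ieexprIz p0 p1) /=.
  rewrite logn1 pfactorK //.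
  have := ha p pp nPp; lia.
(* As the rationals are dense, [O] contains a ball around some rational [r], and it suffices to
   approximate [r]. *)
move=> O O0 oO.
have [x [Ox [r _ rx]]] := @padic_rat_dense p pp O O0 oO.
have : nbhs (ratr r : padic pp) O by rewrite rx; exact: open_nbhs_nbhs.
rewrite -nbhs_ballE => -[e /= e0 xO].
have [s sA hs] := @padic_ratio_approx p _ r e pp
  (fun n m => @bounded_val_mod P p n m pp Pp) e0.
exists (ratr s); split; last by exists s.
by apply: xO; rewrite ballEmdist /= padic_mdist_ratr.
Qed.
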